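(* Let $A_1$ and $A_2$ be Banach algebras and let $\theta\in\Delta(A_2)$. Then the following statements hold. (i) If $A_1\times_\theta A_2$ is cyclically amenable, then $A_2$ is cyclically amenable. (ii) $A_1$ is cyclically amenable if and only if $A_1^\sharp$ is cyclically amenable.
   Context: For a Banach algebra $A$, the dual $A^*$ is an $A$-bimodule via $\langle F\cdot a,x\rangle=\langle F,ax\rangle$ and $\langle a\cdot F,x\rangle=\langle F,xa\rangle$. A linear operator $D:A\to A^*$ is a derivation if $D(ab)=D(a)\cdot b+a\cdot D(b)$ for all $a,b\in A$; it is cyclic if $\langle D(a),b\rangle+\langle D(b),a\rangle=0$ for all $a,b\in A$; an inner derivation is one of the form $\mathrm{ad}_F: a\mapsto F\cdot a-a\cdot F$ with $F\in A^*$. $A$ is cyclically amenable if every cyclic derivation $A\to A^*$ is inner. $\Delta(A)$ is the character space of $A$ (nonzero multiplicative linear functionals). For $\theta\in\Delta(A_2)\cup\{0\}$, the $\theta$-Lau product $A_1\times_\theta A_2$ is the space $A_1\times A_2$ with product $(a_1,a_2)(x_1,x_2)=(a_1x_1+a_1\theta(x_2)+x_1\theta(a_2),\,a_2x_2)$ and norm $\|(a_1,a_2)\|=\|a_1\|+\|a_2\|$. For $A_2=\mathbb{C}$ and $\theta$ the identity map on $\mathbb{C}$ it is $A_1^\sharp$, the unitization of $A_1$. *)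

(* Defs.v *)
From HB Require Import structures.
From mathcomp Require Import all_boot all_order all_algebra.
From mathcomp Require Import all_classical all_reals all_analysis.
From mathcomp Require Import complex.

Set Implicit Arguments.
Unset Strict Implicit.
Unset Printing Implicit Defensive.

Import Order.TTheory GRing.Theory Num.Theory.
Import numFieldNormedType.Exports.

Local Open Scope classical_set_scope.
Local Open Scope ring_scope.
Local Open Scope complex_scope.

(* The algebra structures of ssralg are unital, whereas a Banach algebra need
   not be; hence a separate multiplication on top of completeNormedModType. *)
HB.mixin Record isBanachAlgebra (K : numFieldType) A
    & CompleteNormedModule K A := {
  bmul : A -> A -> A;
  bmulA : associative bmul;
  bmulDl : left_distributive bmul +%R;
  bmulDr : right_distributive bmul +%R;
  bscalerAl : forall (k : K) (a b : A), k *: bmul a b = bmul (k *: a) b;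
  bscalerAr : forall (k : K) (a b : A), k *: bmul a b = bmul a (k *: b);
  ler_normbM : forall a b : A, `|bmul a b| <= `|a| * `|b|
}.

#[short(type="banachAlgType")]
HB.structure Definition BanachAlgebra (K : numFieldType) :=
  {A of CompleteNormedModule K A & isBanachAlgebra K A}.

Notation "a ⋅ b" := (bmul a b) (at level 40, left associativity) : ring_scope.

Lemma bounded_continuous (K : numFieldType) (U V : normedModType K)
    (f : U -> V) (M : K) :
  linear f -> (forall x, `|f x| <= M * `|x|) -> continuous f.
Proof.
move=> fL fM.
pose L : {linear U -> V} := HB.pack f (GRing.isLinear.Build K U V *:%R f fL).
apply: (@bounded_linear_continuous K U V L).
apply/ex_bound; exists `|M|; apply/nbhs_norm0P; exists 1 => //= x /= x1.
have : `|f x| <= `|M * `|x| |.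
  by rewrite (le_trans (fM x))// real_ler_norm// ger0_real// (le_trans _ (fM x)).
move=> /le_trans; apply; rewrite normrM normr_id.
by rewrite ler_piMr// ltW.
Qed.

Section BanachAlgebraTheory.
Variables (K : numFieldType) (A : banachAlgType K).
Implicit Types a b : A.

Lemma bmull_linear a : linear (bmul a).
Proof. by move=> k x y; rewrite bmulDr bscalerAr. Qed.

Lemma bmulr_linear a : linear (bmul ^~ a).
Proof. by move=> k x y; rewrite /= bmulDl bscalerAl. Qed.

Lemma bmulrB a b c : a ⋅ (b - c) = a ⋅ b - a ⋅ c.
Proof. by rewrite bmulDr -scaleN1r -bscalerAr scaleN1r. Qed.

Lemma bmull_continuous a : continuous (bmul a).
Proof.
by apply: (@bounded_continuous _ _ _ _ `|a|) => [|x];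
  [exact: bmull_linear|exact: ler_normbM].
Qed.

Lemma bmulr_continuous a : continuous (bmul ^~ a).
Proof.
apply: (@bounded_continuous _ _ _ _ `|a|) => [|x]; first exact: bmulr_linear.
by rewrite mulrC ler_normbM.
Qed.

End BanachAlgebraTheory.

Section Dual.
Variables (K : numFieldType) (A : normedModType K).

Definition is_dual : {pred A -> K^o} :=
  mem [set f : A -> K^o | linear f /\ continuous f].

Lemma is_dualP (f : A -> K^o) :
  reflect (linear f /\ continuous f) (f \in is_dual).
Proof. by apply: (iffP idP); rewrite inE. Qed.

Lemma is_dual_submod_closed : GRing.submod_closed is_dual.
Proof.
split.
  by apply/is_dualP; split=> [k x y|x]; [rewrite /= scaler0 addr0|exact: cvg_cst].
move=> k f g /is_dualP[fL fC] /is_dualP[gL gC]; apply/is_dualP; split.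
  move=> l x y.
  have E z : (k *: f + g) z = k *: f z + g z by [].
  rewrite !E fL gL !scalerDr !scalerA (mulrC k l) -!addrA; congr (_ + _).
  by rewrite addrCA.
move=> x; apply: cvgD; last exact: gC.
by apply: cvgZr; exact: fC.
Qed.

HB.instance Definition _ :=
  GRing.isSubmodClosed.Build K (A -> K^o) is_dual is_dual_submod_closed.

Record dual := Dual {
  dual_fun :> A -> K^o;
  dual_funP : dual_fun \in is_dual
}.

HB.instance Definition _ := [isSub for dual_fun].
HB.instance Definition _ := [Choice of dual by <:].
HB.instance Definition _ := [SubChoice_isSubLmodule of dual by <:].

Lemma dual_linear (F : dual) : linear F.
Proof. by case/is_dualP: (dual_funP F). Qed.

HB.instance Definition _ (F : dual) :=
  GRing.isLinear.Build K A K^o *:%R F (dual_linear F).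

Lemma dual_continuous (F : dual) : continuous F.
Proof. by case/is_dualP: (dual_funP F). Qed.

End Dual.

Section CyclicAmenability.
Variables (K : numFieldType) (A : banachAlgType K).
Implicit Types (F : dual A) (a b : A).

Fact dactr_subproof F a : (fun x => F (a ⋅ x)) \in @is_dual K A.
Proof.
apply/is_dualP; split=> [k x y|x]; first by rewrite bmull_linear linearP.
apply: (@continuous_comp _ _ _ (bmul a) F); first exact: bmull_continuous.
exact: dual_continuous.
Qed.

Fact dactl_subproof a F : (fun x => F (x ⋅ a)) \in @is_dual K A.
Proof.
apply/is_dualP; split=> [k x y|x]; first by rewrite bmulr_linear linearP.
apply: (@continuous_comp _ _ _ (bmul ^~ a) F); first exact: bmulr_continuous.
exact: dual_continuous.
Qed.

(* dactr F a is F · a and dactl a F is a · F. *)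
Definition dactr F a : dual A := Dual (dactr_subproof F a).
Definition dactl a F : dual A := Dual (dactl_subproof a F).

Definition ad F : A -> dual A := fun a => dactr F a - dactl a F.

(* Continuity is not required; for cyclic D it follows from the closed graph
   theorem. *)
Definition derivation (D : {linear A -> dual A}) :=
  forall a b, D (a ⋅ b) = dactr (D a) b + dactl a (D b).

Definition cyclic_map (D : {linear A -> dual A}) :=
  forall a b, D a b + D b a = 0.

Definition inner_map (D : {linear A -> dual A}) := exists F, D =1 ad F.

Definition cyclically_amenable :=
  forall D : {linear A -> dual A}, derivation D -> cyclic_map D -> inner_map D.

End CyclicAmenability.

Arguments cyclically_amenable {K} A.

Section ComplexBanach.
Variable R : realType.

Lemma ler_normc_ReIm (z : R[i]) : `|z| <= (`|complex.Re z| + `|complex.Im z|)%:C.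
Proof.
rewrite [in leLHS](complexE z) (le_trans (ler_normD _ _))// rmorphD/= normrM.
rewrite [`|'i%C|]normc_def /= expr0n/= add0r expr1n sqrtr1 mul1r.
by rewrite !normc_def/= expr0n/= !addr0 !sqrtr_sqr.
Qed.

Lemma normc_ge_Im (z : R[i]) : `|complex.Im z|%:C <= `|z|.
Proof.
rewrite normc_def lecR -sqrtr_sqr ler_wsqrtr// lerDr.
exact: sqr_ge0.
Qed.

Lemma complex_cauchy_cvg (F : set_system (R[i]^o)) :
  ProperFilter F -> cauchy F -> cvg F.
Proof.
move=> FF /cauchyP Fc.
have part (f : R[i] -> R) : (forall x y, f (x - y) = f x - f y) ->
    (forall z, `|f z|%:C <= `|z|) -> cvg (f @ F).
  move=> fB fn; apply: cauchy_cvg; apply/cauchy_exP => e e0.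
  have e0C : 0 < e%:C by rewrite ltcR.
  have [z Fz] := Fc _ e0C; exists (f z).
  suff: ball z (e%:C) `<=` f @^-1` ball (f z) e by move=> /filterS; exact.
  move=> w zw; rewrite /= -ball_normE /ball_/=.
  have {}zw : `|z - w| < e%:C by move: zw; rewrite -ball_normE.
  by rewrite -fB -ltcR (le_lt_trans (fn _)).
have /cvg_ex[/= a Fa] := part (@complex.Re R) (raddfB _) (@normc_ge_Re R).
have /cvg_ex[/= b Fb] := part (@complex.Im R) (raddfB _) normc_ge_Im.
apply/cvg_ex; exists (a +i* b); apply/cvgrPdist_lt => e e0.
have [er eE] : exists er, e = er%:C.
  by exists (complex.Re e); rewrite RRe_real// gtr0_real.
have er0 : 0 < er / 2 by rewrite divr_gt0// -ltcR -eE.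
move/cvgrPdist_lt : Fa => /(_ _ er0) Fa.
move/cvgrPdist_lt : Fb => /(_ _ er0) Fb.
near=> z; rewrite (le_lt_trans (ler_normc_ReIm _))// eE ltcR (splitr er).
by rewrite !raddfB/= ltrD//; near: z.
Unshelve. all: by end_near. Qed.

End ComplexBanach.

(* ℂ as a Banach algebra over itself; an alias of R[i]^o, because the canonical
   completeness instance of regular modules is the one for realType. *)
Definition Cplx (R : realType) : Type := R[i]^o.

HB.instance Definition _ (R : realType) := NormedModule.copy (Cplx R) R[i]^o.

HB.instance Definition _ (R : realType) :=
  Uniform_isComplete.Build (Cplx R) (@complex_cauchy_cvg R).

Section CplxBanach.
Variable R : realType.
Let mulC (x y : Cplx R) : Cplx R := (x : R[i]) * (y : R[i]).

Let mulCA : associative mulC. Proof. exact: mulrA. Qed.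
Let mulCDl : left_distributive mulC +%R. Proof. exact: mulrDl. Qed.
Let mulCDr : right_distributive mulC +%R. Proof. exact: mulrDr. Qed.
Let mulCZl (k : R[i]) (x y : Cplx R) : k *: mulC x y = mulC (k *: x) y.
Proof. exact: mulrA. Qed.
Let mulCZr (k : R[i]) (x y : Cplx R) : k *: mulC x y = mulC x (k *: y).
Proof. exact: mulrCA. Qed.
Let ler_normMC (x y : Cplx R) : `|mulC x y| <= `|x| * `|y|.
Proof. by rewrite -(@normrM R[i]). Qed.

HB.instance Definition _ := isBanachAlgebra.Build R[i] (Cplx R)
  mulCA mulCDl mulCDr mulCZl mulCZr ler_normMC.
End CplxBanach.

(* The multiplicative linear functionals, that is Δ(A) ∪ {0}. *)
Record multfun (K : numFieldType) (A : banachAlgType K) := MultFun {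
  multfun_fun :> {linear A -> K^o};
  multfunM : forall a b, multfun_fun (a ⋅ b) = multfun_fun a * multfun_fun b
}.

Definition character_space (K : numFieldType) (A : banachAlgType K) :
  set (multfun A) := [set theta | exists a, theta a != 0].

Arguments character_space {K} A _.

Section MultfunContractive.
Variables (R : realType) (A : banachAlgType R[i]).

Lemma neumann (x : A) : `|x| < 1 -> exists y, y = x + x ⋅ y.
Proof.
move=> x1; pose g y := x + x ⋅ y; pose s n := iter n g 0.
have x01 : 0 < 1 - `|x| by rewrite subr_gt0.
have sle n : `|s n| * (1 - `|x|) <= `|x|.
  elim: n => [|n IH]; first by rewrite /s/= normr0 mul0r.
  have : `|s n.+1| * (1 - `|x|) <= (`|x| + `|x| * `|s n|) * (1 - `|x|).
    rewrite ler_pM2r// (le_trans (ler_normD _ _))// lerD2l.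
    exact: ler_normbM.
  move=> /le_trans; apply.
  rewrite mulrDl -mulrA -[leRHS]mulr1 -mulrDr ler_wpM2l//.
  by rewrite -[leRHS](subrK `|x|) lerD2l.
have sD N n : `|s (N + n)%N - s N| <= `|x| ^+ N * `|s n|.
  elim: N => [|N IH]; first by rewrite add0n /s/= subr0 expr0 mul1r.
  rewrite addSn /s !iterS -/(s _) -/(s _) /g opprD addrACA subrr add0r.
  rewrite -bmulrB (le_trans (ler_normbM _ _))// exprS -mulrA.
  by rewrite ler_wpM2l.
have [r rE] : exists r, `|x| = r%:C.
  by exists (complex.Re `|x|); rewrite RRe_real// normr_real.
have r0 : 0 <= r by rewrite -lecR -rE; exact: normr_ge0.
have r1 : r < 1 by rewrite -ltcR -rE; exact: x1.
have sC : cauchy (s @ \oo).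
  apply: cauchy_exP => e e0.
  have := mulr_gt0 e0 x01.
  have [d dE] : exists d, e * (1 - `|x|) = d%:C.
    exists (complex.Re (e * (1 - `|x|))).
    by rewrite RRe_real// gtr0_real// mulr_gt0.
  rewrite {1}dE ltcR => d0.
  have : (fun n => r ^+ n : R) @ \oo --> (0 : R).
    by apply: cvg_expr; rewrite ger0_norm.
  move=> /cvgrPdist_lt /(_ _ d0) [N _ /(_ N (leqnn N))].
  rewrite /= sub0r normrN ger0_norm ?exprn_ge0// => rNd.
  exists (s N); exists N => // n /= Nn.
  rewrite -ball_normE /ball_/= distrC -(subnKC Nn).
  rewrite -(ltr_pM2r x01) dE.
  apply: (@le_lt_trans _ _ (`|x| ^+ N * `|x|)).
    apply: (@le_trans _ _ (`|x| ^+ N * `|s (n - N)%N| * (1 - `|x|))).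
      by rewrite ler_pM2r.
    by rewrite -mulrA ler_wpM2l ?exprn_ge0.
  apply: (@le_lt_trans _ _ (`|x| ^+ N)).
    by rewrite ler_piMr ?exprn_ge0// ltW.
  by rewrite rE -rmorphXn ltcR.
have /cvg_ex[/= y sy] : cvg (s @ \oo) by exact: cauchy_cvg.
exists y.
have H1 : (fun n => s n.+1) @ \oo --> y by rewrite cvg_shiftS.
have H2 : (fun n => s n.+1) @ \oo --> x + x ⋅ y.
  have H3 : (fun n => x ⋅ s n) @ \oo --> x ⋅ y.
    by apply: continuous_cvg; last exact: sy; exact: bmull_continuous.
  have -> : (fun n => s n.+1) = cst x + (fun n => x ⋅ s n) by [].
  by apply: cvgD H3; exact: cvg_cst.
exact: (cvg_unique _ H1 H2).
Qed.

Lemma multfun_contractive (theta : multfun A) a : `|theta a| <= `|a|.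
Proof.
rewrite real_leNgt ?normr_real//; apply/negP => lt_a.
have t0 : theta a != 0 by rewrite -normr_gt0 (le_lt_trans _ lt_a).
pose x := (theta a)^-1 *: a.
have tx : theta x = 1 by rewrite linearZ/= /GRing.scale/= mulVf.
have [|y yE] := @neumann x.
  by rewrite normrZ normfV mulrC ltr_pdivrMr ?normr_gt0// mul1r.
have : theta y = 1 + theta y by rewrite {1}yE linearD/= multfunM tx mul1r.
move/eqP; rewrite -subr_eq0 opprD addrCA subrr addr0 oppr_eq0.
by rewrite oner_eq0.
Qed.

End MultfunContractive.

Definition lau (R : realType) (A1 A2 : banachAlgType R[i])
  (theta : multfun A2) : Type := (A1 * A2)%type.

Section Lau.
Variables (R : realType) (A1 A2 : banachAlgType R[i]) (theta : multfun A2).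
Local Notation L := (lau A1 theta).

HB.instance Definition _ := GRing.Lmodule.copy L (A1 * A2)%type.

Definition lau_norm (a : L) : R[i] := `|a.1| + `|a.2|.

Fact ler_lau_normD (a b : L) : lau_norm (a + b) <= lau_norm a + lau_norm b.
Proof. by rewrite /lau_norm addrACA lerD//; exact: ler_normD. Qed.

Fact lau_normZ (k : R[i]) (a : L) : lau_norm (k *: a) = `|k| * lau_norm a.
Proof. by rewrite /lau_norm/= !normrZ mulrDr. Qed.

Fact lau_norm0_eq0 (a : L) : lau_norm a = 0 -> a = 0.
Proof.
case: a => a1 a2 /eqP; rewrite /lau_norm/= paddr_eq0// !normr_eq0.
by move=> /andP[/eqP -> /eqP ->].
Qed.

HB.instance Definition _ :=
  Lmodule_isNormed.Build R[i] L ler_lau_normD lau_normZ lau_norm0_eq0.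

Lemma lau_normE (a : L) : `|a| = `|a.1| + `|a.2|. Proof. by []. Qed.

Fact lau_cauchy_cvg (F : set_system L) : ProperFilter F -> cauchy F -> cvg F.
Proof.
move=> FF /cauchyP Fc.
have part (A : banachAlgType R[i]) (f : L -> A) :
    (forall x y, f (x - y) = f x - f y) -> (forall z, `|f z| <= `|z|) ->
    cvg (f @ F).
  move=> fB fn; apply: cauchy_cvg; apply/cauchy_exP => e e0.
  have [z Fz] := Fc _ e0; exists (f z).
  suff: ball z e `<=` f @^-1` ball (f z) e by move=> /filterS; exact.
  move=> w zw; rewrite /= -ball_normE /ball_/=.
  have {}zw : `|z - w| < e by move: zw; rewrite -ball_normE.
  by rewrite -fB (le_lt_trans (fn _)).
have /cvg_ex[/= a Fa] : cvg ((fun x : L => x.1) @ F).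
  by apply: part => // z; rewrite lau_normE lerDl.
have /cvg_ex[/= b Fb] : cvg ((fun x : L => x.2) @ F).
  by apply: part => // z; rewrite lau_normE lerDr.
apply/cvg_ex; exists ((a, b) : L); apply/cvgrPdist_lt => e e0.
have e20 : 0 < e / 2 by rewrite divr_gt0.
move/cvgrPdist_lt : Fa => /(_ _ e20) Fa.
move/cvgrPdist_lt : Fb => /(_ _ e20) Fb.
near=> z; rewrite lau_normE (splitr e)/=.
by rewrite ltrD//; near: z.
Unshelve. all: by end_near. Qed.

HB.instance Definition _ := Uniform_isComplete.Build L lau_cauchy_cvg.

Definition lau_mul (a x : L) : L :=
  (a.1 ⋅ x.1 + theta x.2 *: a.1 + theta a.2 *: x.1, a.2 ⋅ x.2).

Fact lau_mulDl : left_distributive lau_mul +%R.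
Proof.
move=> a b c; congr pair => /=; last by rewrite bmulDl.
rewrite bmulDl scalerDr [theta (_ + _)]linearD scalerDl.
by rewrite [LHS](AC (2*2*2) ((1*3*5)*(2*4*6))).
Qed.

Fact lau_mulDr : right_distributive lau_mul +%R.
Proof.
move=> a b c; congr pair => /=; last by rewrite bmulDr.
rewrite bmulDr scalerDr [theta (_ + _)]linearD scalerDl.
by rewrite [LHS](AC (2*2*2) ((1*3*5)*(2*4*6))).
Qed.

Fact lau_mulZl (k : R[i]) (a b : L) :
  k *: lau_mul a b = lau_mul (k *: a) b.
Proof.
congr pair => /=; last by rewrite bscalerAl.
by rewrite !scalerDr [theta (_ *: _)]linearZ bscalerAl !scalerA (mulrC k (theta b.2)).
Qed.

Fact lau_mulZr (k : R[i]) (a b : L) :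
  k *: lau_mul a b = lau_mul a (k *: b).
Proof.
congr pair => /=; last by rewrite bscalerAr.
by rewrite !scalerDr [theta (_ *: _)]linearZ bscalerAr !scalerA (mulrC k (theta a.2)).
Qed.

Fact lau_mulA : associative lau_mul.
Proof.
move=> a b c; congr pair => /=; last by rewrite bmulA.
rewrite !multfunM !bmulDl !bmulDr !scalerDr bmulA.
rewrite -!bscalerAl -!bscalerAr !scalerA !(mulrC (theta c.2)).
by rewrite [LHS](AC (3*1*3) ((1*3*5)*(2*4*6)*7)).
Qed.

Fact ler_norm_lauM (a b : L) : `|lau_mul a b| <= `|a| * `|b|.
Proof.
rewrite !lau_normE /=.
apply: (@le_trans _ _ (`|a.1| * `|b.1| + `|b.2| * `|a.1| + `|a.2| * `|b.1|
                       + `|a.2| * `|b.2|)).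
  rewrite lerD ?ler_normbM// (le_trans (ler_normD _ _))// lerD//.
    rewrite (le_trans (ler_normD _ _))// lerD ?ler_normbM//.
    by rewrite normrZ ler_wpM2r// multfun_contractive.
  by rewrite normrZ ler_wpM2r// multfun_contractive.
by rewrite mulrDl !mulrDr (mulrC `|b.2|) !addrA.
Qed.

HB.instance Definition _ := isBanachAlgebra.Build R[i] L
  lau_mulA lau_mulDl lau_mulDr lau_mulZl lau_mulZr ler_norm_lauM.

End Lau.

Section Unitization.
Variable R : realType.

Definition idC (z : Cplx R) : R[i]^o := z.

Fact idC_linear : linear idC. Proof. by []. Qed.

HB.instance Definition _ :=
  GRing.isLinear.Build R[i] (Cplx R) R[i]^o *:%R idC idC_linear.

Fact idC_mul (z w : Cplx R) : idC (z ⋅ w) = idC z * idC w. Proof. by []. Qed.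

Definition idC_multfun : multfun (Cplx R) := MultFun idC_mul.

Definition unitization (A : banachAlgType R[i]) : banachAlgType R[i] :=
  lau A idC_multfun.

End Unitization.

(* Main.v *)
(** Cyclic derivations are pulled back along the coordinate maps
    of [L = A1 ×_θ A2] and its inclusions. The projection onto [A2] and both
    inclusions are homomorphisms, so pulling back along them preserves
    derivations, and along the inclusions it preserves innerness. The
    projection onto [A1] is not multiplicative, but the defect it produces in
    the Leibniz rule for [d] at [(a, b)] is a multiple of [d a b + d b a], which
    vanishes for cyclic [d]. Conversely, a cyclic derivation [D] of the
    unitization kills the unit [e] (as [D e = D (e e) = 2 D e]), and
    [D x e = - D e x = 0], so [D] is the pullback of its restriction to [A1]. *)

From HB Require Import structures.
Require Import Defs.
From mathcomp Require Import all_boot all_order all_algebra.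
From mathcomp Require Import all_classical all_reals all_analysis.
From mathcomp Require Import complex ring.

Local Open Scope ring_scope.
Local Open Scope complex_scope.

Import Order.TTheory GRing.Theory Num.Theory.
Import numFieldNormedType.Exports.

Set Implicit Arguments.
Unset Strict Implicit.
Unset Printing Implicit Defensive.

Lemma bmul0l (K : numFieldType) (A : banachAlgType K) (a : A) : 0 ⋅ a = 0.
Proof. by rewrite -(scale0r (0 : A)) -bscalerAl !scale0r. Qed.

Lemma bmul0r (K : numFieldType) (A : banachAlgType K) (a : A) : a ⋅ 0 = 0.
Proof. by rewrite -(scale0r (0 : A)) -bscalerAr !scale0r. Qed.

Lemma dual_ext (K : numFieldType) (A : normedModType K) (F G : dual A) :
  (forall x, F x = G x) -> F = G.
Proof. by move=> FG; apply/val_inj/funext. Qed.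

Lemma dual_addE (K : numFieldType) (A : normedModType K) (F G : dual A) x :
  (F + G) x = F x + G x.
Proof. by []. Qed.

Lemma dual_scaleE (K : numFieldType) (A : normedModType K) k (F : dual A) x :
  (k *: F) x = k * F x.
Proof. by []. Qed.

(** Evaluating at a point turns the module actions into products inside the arguments, where a
    homomorphism can be substituted directly. *)
Lemma derivationP (K : numFieldType) (A : banachAlgType K)
    (D : {linear A -> dual A}) :
  derivation D <-> forall a b x, D (a ⋅ b) x = D a (b ⋅ x) + D b (x ⋅ a).
Proof.
split=> [dD a b x|dD a b]; first by rewrite dD.
by apply: dual_ext => x; rewrite dD.
Qed.

Lemma inner_mapP (K : numFieldType) (A : banachAlgType K)
    (D : {linear A -> dual A}) :
  inner_map D <->
  exists F : dual A, forall a x, D a x = F (a ⋅ x) - F (x ⋅ a).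
Proof.
split=> -[F DF]; exists F; first by move=> a x; rewrite DF.
by move=> a; apply: dual_ext => x; rewrite DF.
Qed.

Section Pullback.
Variables (K : numFieldType) (A B : banachAlgType K) (phi : {linear A -> B}).
Hypothesis phi_cont : continuous phi.

Fact dual_pullback_subproof (F : dual B) : (F \o phi) \in @is_dual K A.
Proof.
apply/is_dualP; split=> [k x y|x]; first by rewrite /= !linearP.
by apply: continuous_comp; [exact: phi_cont|exact: dual_continuous].
Qed.

(** The adjoint of [phi], applied to [F]. *)
Definition dual_pullback (F : dual B) : dual A :=
  Dual (dual_pullback_subproof F).

(** Viewing [D] as the bilinear form [D a x], this substitutes [phi] in both arguments. *)
Definition pullback_fun (D : {linear B -> dual B}) (a : A) : dual A :=
  dual_pullback (D (phi a)).

Fact pullback_fun_linear D : linear (pullback_fun D).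
Proof.
by move=> k x y; apply/val_inj/funext => z; rewrite /pullback_fun/= !linearP.
Qed.

HB.instance Definition _ D :=
  GRing.isLinear.Build K A (dual A) *:%R (pullback_fun D)
    (pullback_fun_linear D).

Definition pullback (D : {linear B -> dual B}) : {linear A -> dual A} :=
  pullback_fun D.

Lemma pullbackE D a x : pullback D a x = D (phi a) (phi x).
Proof. by []. Qed.

Lemma pullback_cyclic D : cyclic_map D -> cyclic_map (pullback D).
Proof. by move=> cD a b; exact: cD. Qed.

Hypothesis phiM : forall a b, phi (a ⋅ b) = phi a ⋅ phi b.

Lemma pullback_derivation D : derivation D -> derivation (pullback D).
Proof.
move=> /derivationP dD; apply/derivationP => a b x.
by rewrite !pullbackE !phiM dD.
Qed.

Lemma pullback_inner D : inner_map D -> inner_map (pullback D).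
Proof.
move=> /inner_mapP[F DF]; apply/inner_mapP; exists (dual_pullback F) => a x.
by rewrite pullbackE DF /= !phiM.
Qed.

End Pullback.

(** Identifies a double pullback along an inclusion and its projection with the original map. *)
Lemma inner_map_eq (K : numFieldType) (A : banachAlgType K)
    (D E : {linear A -> dual A}) :
  (forall a x, D a x = E a x) -> inner_map D -> inner_map E.
Proof.
move=> DE [F DF]; exists F => a; rewrite -DF.
by apply/val_inj/funext => x; rewrite /= -DE.
Qed.

Section LauMaps.
Variables (R : realType) (A1 A2 : banachAlgType R[i]) (theta : multfun A2).
Local Notation L := (lau A1 theta).

Definition lau_fst (x : L) : A1 := x.1.
Definition lau_snd (x : L) : A2 := x.2.
Definition lau_inl (a : A1) : L := (a, 0).
Definition lau_inr (a : A2) : L := (0, a).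

Fact lau_fst_linear : linear lau_fst. Proof. by []. Qed.
Fact lau_snd_linear : linear lau_snd. Proof. by []. Qed.
Fact lau_inl_linear : linear lau_inl.
Proof. by move=> k x y; congr pair; rewrite /= scaler0 addr0. Qed.
Fact lau_inr_linear : linear lau_inr.
Proof. by move=> k x y; congr pair; rewrite /= scaler0 addr0. Qed.

HB.instance Definition _ :=
  GRing.isLinear.Build R[i] L A1 *:%R lau_fst lau_fst_linear.
HB.instance Definition _ :=
  GRing.isLinear.Build R[i] L A2 *:%R lau_snd lau_snd_linear.
HB.instance Definition _ :=
  GRing.isLinear.Build R[i] A1 L *:%R lau_inl lau_inl_linear.
HB.instance Definition _ :=
  GRing.isLinear.Build R[i] A2 L *:%R lau_inr lau_inr_linear.

(** For the sum norm the projections are contractive and the inclusions isometric, so the bound 1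
    serves for all four maps. *)
Lemma lau_fst_continuous : continuous lau_fst.
Proof.
apply: (bounded_continuous (M := 1)) => [|x]; first exact: lau_fst_linear.
by rewrite mul1r lau_normE lerDl.
Qed.

Lemma lau_snd_continuous : continuous lau_snd.
Proof.
apply: (bounded_continuous (M := 1)) => [|x]; first exact: lau_snd_linear.
by rewrite mul1r lau_normE lerDr.
Qed.

Lemma lau_inl_continuous : continuous lau_inl.
Proof.
apply: (bounded_continuous (M := 1)) => [|x]; first exact: lau_inl_linear.
by rewrite mul1r lau_normE/= normr0 addr0.
Qed.

Lemma lau_inr_continuous : continuous lau_inr.
Proof.
apply: (bounded_continuous (M := 1)) => [|x]; first exact: lau_inr_linear.
by rewrite mul1r lau_normE/= normr0 add0r.
Qed.

Lemma lau_mulE (a x : L) :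
  a ⋅ x = (a.1 ⋅ x.1 + theta x.2 *: a.1 + theta a.2 *: x.1, a.2 ⋅ x.2).
Proof. by []. Qed.

Lemma lau_sndM a b : lau_snd (a ⋅ b) = lau_snd a ⋅ lau_snd b.
Proof. by []. Qed.

Lemma lau_inlM a b : lau_inl (a ⋅ b) = lau_inl a ⋅ lau_inl b.
Proof. by rewrite lau_mulE/= linear0 !scale0r !addr0 bmul0l. Qed.

Lemma lau_inrM a b : lau_inr (a ⋅ b) = lau_inr a ⋅ lau_inr b.
Proof. by rewrite lau_mulE/= !scaler0 !addr0 bmul0l. Qed.

(** In the Leibniz rule the terms in [theta a.2] and [theta b.2] agree on both sides; those in
    [theta x.2] add up to a multiple of [d a.1 b.1 + d b.1 a.1], which is zero. *)
Lemma lau_fst_derivation (d : {linear A1 -> dual A1}) :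
  derivation d -> cyclic_map d -> derivation (pullback lau_fst_continuous d).
Proof.
move=> /derivationP dd cd; apply/derivationP => a b x.
have dZ k u v : d u (k *: v) = k * d u v by rewrite linearZ.
have dD u v w : d u (v + w) = d u v + d u w by rewrite linearD.
have dba : d b.1 a.1 = - d a.1 b.1 by apply/eqP; rewrite -addr_eq0 addrC cd.
(* The goal up to conversion, with the products of [L] unfolded so that linearity of [d] can expand
   them. *)
suff : d (a.1 ⋅ b.1 + theta b.2 *: a.1 + theta a.2 *: b.1) x.1 =
    d a.1 (b.1 ⋅ x.1 + theta x.2 *: b.1 + theta b.2 *: x.1) +
    d b.1 (x.1 ⋅ a.1 + theta a.2 *: x.1 + theta x.2 *: a.1) by [].
rewrite !dD !dZ !linearD !dual_addE dd !linearZ !dual_scaleE dba.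
ring.
Qed.

(** Since [lau_snd] after [lau_inr] is the identity, lifting [d] to [L] and restricting it again
    gives back [d]; innerness obtained on [L] thus descends. *)
Lemma cyclically_amenable_lau_snd :
  cyclically_amenable (lau A1 theta) -> cyclically_amenable A2.
Proof.
move=> caL d dd cd.
have := caL _ (pullback_derivation lau_snd_continuous lau_sndM dd)
  (pullback_cyclic lau_snd_continuous cd).
move=> /(pullback_inner lau_inr_continuous lau_inrM).
exact: inner_map_eq.
Qed.

Lemma cyclically_amenable_lau_fst :
  cyclically_amenable (lau A1 theta) -> cyclically_amenable A1.
Proof.
move=> caL d dd cd.
have := caL _ (lau_fst_derivation dd cd)
  (pullback_cyclic lau_fst_continuous cd).
move=> /(pullback_inner lau_inl_continuous lau_inlM).
exact: inner_map_eq.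
Qed.

End LauMaps.

(** The Leibniz rule at [e ⋅ e] reads [D e x = D e x + D e x]. *)
Lemma derivation_unit (K : numFieldType) (A : banachAlgType K) (e : A)
    (D : {linear A -> dual A}) :
  left_id e (@bmul K A) -> right_id e (@bmul K A) ->
  derivation D -> D e = 0.
Proof.
move=> e1 e2 /derivationP dD; apply: dual_ext => x.
have := dD e e x; rewrite !e1 e2 => /eqP.
by rewrite -subr_eq0 opprD addNKr oppr_eq0 => /eqP.
Qed.

Lemma cyclically_amenable_unitization (R : realType) (A : banachAlgType R[i]) :
  cyclically_amenable A -> cyclically_amenable (unitization A).
Proof.
move=> caA D dD cD; pose e : unitization A := (0, 1 : R[i]).
have e1 : left_id e (@bmul _ (unitization A)).
  case=> a z; rewrite lau_mulE/= bmul0l scaler0 !add0r /idC scale1r.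
  by congr pair; exact: mul1r.
have e2 : right_id e (@bmul _ (unitization A)).
  case=> a z; rewrite lau_mulE/= bmul0r scaler0 addr0 add0r /idC scale1r.
  by congr pair; exact: mulr1.
have De : D e = 0 by exact: derivation_unit e1 e2 dD.
(* Cyclicity carries the vanishing over to the second argument. *)
have De' a : D a e = 0 by have := cD a e; rewrite De addr0.
have lauE (a : unitization A) : a = lau_inl _ (lau_fst a) + lau_snd a *: e.
  case: a => a z; congr pair; rewrite /= ?scaler0 ?addr0// add0r.
  by rewrite /GRing.scale/= mulr1.
pose j := @lau_inl_continuous R A _ (idC_multfun R).
have jM := @lau_inlM R A _ (idC_multfun R).
have /inner_mapP[F DF] := caA _ (pullback_derivation j jM dD)
  (pullback_cyclic j cD).
(* [F] implements the restriction of [D] to [A]; the witness extends [F] by zero on the multiples of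
   [e]. *)
apply/inner_mapP; exists (dual_pullback (@lau_fst_continuous R A _ _) F) => a x.
have DE k l u v : D (u + k *: e) (v + l *: e) = D u v.
  have DZ : D (k *: e) = 0 by rewrite linearZ/= De scaler0.
  have DeZ : D u (l *: e) = 0 by rewrite linearZ/= De' scaler0.
  have -> : D (u + k *: e) = D u by rewrite -[RHS]addr0 -DZ; exact: linearD.
  by rewrite -[RHS]addr0 -DeZ; exact: linearD.
rewrite [in LHS](lauE a) [in LHS](lauE x) DE -(pullbackE j) DF.
have FB u v : F u - F v = F (u - v) by rewrite linearB.
rewrite FB [RHS](FB (a ⋅ x).1 (x ⋅ a).1); congr (F _).
(* The first coordinates of [a ⋅ x] and [x ⋅ a] carry the same two scalar terms in opposite order;
   once aligned, they cancel in the difference. *)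
rewrite !lau_mulE/= [_ + _ *: x.1 in RHS]addrAC.
have addrK2 p q t : p + t - (q + t) = p - q :> A.
  by rewrite opprD addrACA subrr addr0.
by rewrite !addrK2.
Qed.

Theorem theorem3p4 (R : realType) (A1 A2 : banachAlgType R[i])
    (theta : multfun A2) (htheta : character_space A2 theta) :
  (cyclically_amenable (lau A1 theta) -> cyclically_amenable A2)
  /\ (cyclically_amenable A1 <-> cyclically_amenable (unitization A1)).
Proof.
split; first exact: cyclically_amenable_lau_snd.
split; first exact: cyclically_amenable_unitization.
(* The unitization is by definition the Lau product with the identity character of ℂ. *)
exact: cyclically_amenable_lau_fst.
Qed.
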